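(* Let $n\ge 1$. For every $A\in\mathrm{ASM}(n)$ and every $i\in[n-1]$, $\pi_i(m_A)=m_{\pi_i(A)}$. Hence $\mathrm{ASM}(n)\cong \mathrm{MT}(n)$ as posets under weak order.
   Context: $[n]=\{1,\dots,n\}$. An $n\times n$ alternating sign matrix (ASM) is a matrix $A=(A_{i,j})$ with entries in $\{-1,0,1\}$ such that $\sum_{j=1}^m A_{i,j}\in\{0,1\}$ for all $i,m\in[n]$, $\sum_{i=1}^m A_{i,j}\in\{0,1\}$ for all $j,m\in[n]$, and the sum of all entries is $n$; $\mathrm{ASM}(n)$ is the set of these. The corner sum function of $A$ is $\mathrm{rk}_A(i,j)=\sum_{a\in[i],\,b\in[j]}A_{a,b}$. Strong order on $\mathrm{ASM}(n)$: $A\le B$ iff $\mathrm{rk}_A(i,j)\ge \mathrm{rk}_B(i,j)$ for all $i,j\in[n]$. For $i\in[n-1]$, $\pi_i(A)$ is the minimum, in strong order, of $\{B\in\mathrm{ASM}(n): \mathrm{rk}_B(a,b)=\mathrm{rk}_A(a,b)\text{ for all }a,b\in[n]\text{ with }a\ne i\}$ (this minimum is known to exist). Weak order on $\mathrm{ASM}(n)$ is the transitive closure of the relations $\pi_i(A)\prec A$ for $i\in[n-1]$ with $\pi_i(A)\neq A$ (together with equality). A monotone triangle of size $n$ is an array $m=(m(i,j))_{1\le j\le i\le n}$ with entries in $[n]$ such that $m(i,j)<m(i,j+1)$, $m(i,j)\le m(i-1,j)$ and $m(i,j)\le m(i+1,j+1)$ whenever both sides are defined; $\mathrm{MT}(n)$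 is the set of these. For $A\in\mathrm{ASM}(n)$, let $\widetilde A$ be the matrix whose $i$th row is the sum of the first $i$ rows of $A$; it has entries in $\{0,1\}$ with exactly $i$ ones in row $i$. The monotone triangle $m_A$ has as its $i$th row $m_A(i,1)<\dots<m_A(i,i)$ the increasing list of column indices of the ones in row $i$ of $\widetilde A$; $A\mapsto m_A$ is a bijection $\mathrm{ASM}(n)\to\mathrm{MT}(n)$. For $m\in\mathrm{MT}(n)$ and $i\in[n-1]$, $\pi_i(m)$ is the monotone triangle agreeing with $m$ in all rows $j\ne i$ and whose row $i$ is entrywise minimal among all elements of $\mathrm{MT}(n)$ that agree with $m$ outside row $i$ (this is known to be well defined). Weak order on $\mathrm{MT}(n)$ is the transitive closure of the relations $\pi_i(m)\prec m$ for $i\in[n-1]$ with $\pi_i(m)\ne m$ (together with equality). *)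

(* Defs.v *)
From HB Require Import structures.
From mathcomp Require Import all_boot all_order all_algebra zify.

Set Implicit Arguments.
Unset Strict Implicit.
Unset Printing Implicit Defensive.

Import Order.TTheory GRing.Theory Num.Theory.
Local Open Scope ring_scope.

(* Rows, columns and positions are 0-based: k : 'I_n stands for k + 1 in [n],
   and i : 'I_n.-1 stands for i + 1 in [n - 1]. *)

Section AlternatingSignMatrices.
Variable n : nat.

Definition is_asm (A : 'M[int]_n) : bool :=
  [&& [forall i, forall j, A i j \in [:: -1; 0; 1]],
      [forall i, forall m : 'I_n, \sum_(j < n | (j <= m)%N) A i j \in [:: 0; 1]],
      [forall j, forall m : 'I_n, \sum_(i < n | (i <= m)%N) A i j \in [:: 0; 1]]
    & \sum_i \sum_j A i j == n%:Z].

Record asm : predArgType :=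
  Asm { asm_mx :> 'M[int]_n; asm_mxP : is_asm asm_mx }.

HB.instance Definition _ := [isSub for asm_mx].
HB.instance Definition _ := [Countable of asm by <:].

(* The entries are encoded in 'I_3 only to show that asm is finite. *)
Definition asm_code (A : asm) : 'M['I_3]_n :=
  \matrix_(i, j) inord (absz (A i j + 1)).

Definition asm_decode (M : 'M['I_3]_n) : option asm :=
  insub (\matrix_(i, j) ((M i j)%:Z - 1)).

Lemma asm_codeK : pcancel asm_code asm_decode.
Proof.
move=> A; rewrite /asm_decode.
suff -> : \matrix_(i, j) ((asm_code A i j)%:Z - 1) = asm_mx A by rewrite valK.
apply/matrixP => i j; rewrite !mxE.
have /and4P[/forallP /(_ i) /forallP /(_ j) + _ _ _] := asm_mxP A.
by rewrite !inE => /or3P[] /eqP ->; rewrite inordK.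
Qed.

HB.instance Definition _ : isFinite asm := PCanIsFinite asm_codeK.

Implicit Types A B C : asm.

Definition rk A (i j : 'I_n) : int :=
  \sum_(a < n | (a <= i)%N) \sum_(b < n | (b <= j)%N) A a b.

Definition asm_strong_le A B : bool :=
  [forall i, forall j, rk B i j <= rk A i j].

Definition asm_agree_off (i : nat) A B : bool :=
  [forall a : 'I_n, forall b : 'I_n, (a != i :> nat) ==> (rk B a b == rk A a b)].

(* The minimum always exists and is unique, so that the default value A of
   odflt is never used. *)
Definition asm_pi (i : 'I_n.-1) A : asm :=
  odflt A [pick B | asm_agree_off i A B &&
    [forall C, asm_agree_off i A C ==> asm_strong_le B C]].

Definition asm_weak_step A B : bool :=
  [exists i : 'I_n.-1, A == asm_pi i B] && (A != B).

Definition asm_weak_le A B : bool := connect asm_weak_step A B.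

Lemma prefix_sum_inj (F G : 'I_n -> int) :
  (forall i : 'I_n, \sum_(a < n | (a <= i)%N) F a
                    = \sum_(a < n | (a <= i)%N) G a) -> F =1 G.
Proof.
move=> FG i; have [k] := ubnP (i : nat); elim: k i => // k IHk i ltik.
have := FG i; rewrite (bigD1 i) //= [RHS](bigD1 i) //=.
rewrite [X in F i + X](_ : _ = \sum_(a < n | (a <= i)%N && (a != i)) G a).
  by move/addIr.
apply: eq_bigr => a /andP[leai neai]; apply: IHk.
by move: neai; rewrite -val_eqE /=; lia.
Qed.

Lemma asm_strong_le_refl : reflexive asm_strong_le.
Proof. by move=> A; apply/forallP=> i; apply/forallP=> j. Qed.

Lemma asm_strong_le_trans : transitive asm_strong_le.
Proof.
move=> B A C /forallP AB /forallP BC; apply/forallP=> i; apply/forallP=> j.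
by apply: le_trans (forallP (BC i) j) (forallP (AB i) j).
Qed.

Lemma asm_strong_le_anti : antisymmetric asm_strong_le.
Proof.
move=> A B /andP[/forallP AB /forallP BA].
have eqrk i j : rk A i j = rk B i j.
  by apply/le_anti; rewrite (forallP (AB i) j) (forallP (BA i) j).
apply/val_inj/matrixP=> a b; move: b; apply: prefix_sum_inj => j.
move: a; apply: (@prefix_sum_inj (fun a => \sum_(b < n | (b <= j)%N) A a b)).
by move=> i; apply: eqrk.
Qed.

Lemma asm_pi_le i A : asm_strong_le (asm_pi i A) A.
Proof.
rewrite /asm_pi; case: pickP => [B /andP[_ /forallP /(_ A) /implyP]|_] /=.
  apply; apply/forallP=> a; apply/forallP=> b.
  by rewrite eqxx implybT.
exact: asm_strong_le_refl.
Qed.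

Lemma asm_weak_strong A B : asm_weak_le A B -> asm_strong_le A B.
Proof.
case/connectP=> p; elim: p A => [|C p IHp] A /=.
  by move=> _ ->; apply: asm_strong_le_refl.
case/andP=> /andP[/existsP[i /eqP ->] _] pthp /(IHp _ pthp).
exact/asm_strong_le_trans/asm_pi_le.
Qed.

Lemma asm_weak_le_refl : reflexive asm_weak_le.
Proof. exact: connect0. Qed.

Lemma asm_weak_le_anti : antisymmetric asm_weak_le.
Proof.
move=> A B /andP[/asm_weak_strong AB /asm_weak_strong BA].
by apply: asm_strong_le_anti; rewrite AB BA.
Qed.

Lemma asm_weak_le_trans : transitive asm_weak_le.
Proof. exact: connect_trans. Qed.

End AlternatingSignMatrices.

Section MonotoneTriangles.
Variable n : nat.

(* The position (i, j) of a triangular array is Tagged _ j; since i : 'I_n is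
   0-based, row i has i.+1 positions. *)
Definition tri : finType := {i : 'I_n & 'I_i.+1}.

Definition trow (p : tri) : nat := tag p.
Definition tcol (p : tri) : nat := tagged p.

Definition is_mt (m : {ffun tri -> 'I_n}) : bool :=
  [forall p, forall q,
    [&& (trow q == trow p) && (tcol q == (tcol p).+1) ==> (m p < m q)%N,
        (trow p == (trow q).+1) && (tcol q == tcol p) ==> (m p <= m q)%N
      & (trow q == (trow p).+1) && (tcol q == (tcol p).+1) ==> (m p <= m q)%N]].

Record mt : predArgType :=
  Mt { mt_fun :> {ffun tri -> 'I_n}; mt_funP : is_mt mt_fun }.

HB.instance Definition _ := [isSub for mt_fun].
HB.instance Definition _ := [Finite of mt by <:].

Implicit Types m : mt.

Definition mt_agree_off (i : nat) m m' : bool :=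
  [forall p, (trow p != i) ==> (m' p == m p)].

Definition mt_row_le (i : nat) m m' : bool :=
  [forall p, (trow p == i) ==> (m p <= m' p)%N].

(* The minimum always exists and is unique, so that the default value m of
   odflt is never used. *)
Definition mt_pi (i : 'I_n.-1) m : mt :=
  odflt m [pick m' | mt_agree_off i m m' &&
    [forall m'', mt_agree_off i m m'' ==> mt_row_le i m' m'']].

Definition mt_weak_step m m' : bool :=
  [exists i : 'I_n.-1, m == mt_pi i m'] && (m != m').

Definition mt_weak_le m m' : bool := connect mt_weak_step m m'.

Lemma mt_pi_le i m p : (mt_pi i m p <= m p)%N.
Proof.
rewrite /mt_pi; case: pickP => [m' /andP[agr minm']|_] //=.
have [rowp|nrowp] := eqVneq (trow p) i; last first.
  by have /implyP/(_ nrowp)/eqP-> := forallP agr p.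
have magr : mt_agree_off i m m by apply/forallP=> q; rewrite eqxx implybT.
have /forallP/(_ p) := implyP (forallP minm' m) magr.
by rewrite rowp eqxx.
Qed.

Lemma mt_weak_entry m m' p : mt_weak_le m m' -> (m p <= m' p)%N.
Proof.
case/connectP=> s; elim: s m => [|m1 s IHs] m /=; first by move=> _ ->.
case/andP=> /andP[/existsP[i /eqP ->] _] pths /(IHs _ pths).
exact/leq_trans/mt_pi_le.
Qed.

Lemma mt_weak_le_refl : reflexive mt_weak_le.
Proof. exact: connect0. Qed.

Lemma mt_weak_le_anti : antisymmetric mt_weak_le.
Proof.
move=> m m' /andP[le_mm' le_m'm]; apply/val_inj/ffunP=> p; apply/val_inj/anti_leq.
by rewrite !mt_weak_entry.
Qed.

Lemma mt_weak_le_trans : transitive mt_weak_le.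
Proof. exact: connect_trans. Qed.

End MonotoneTriangles.

Fact weak_display : Order.disp_t. Proof. exact: Order.Disp tt tt. Qed.

(* The canonical order on asm n and on mt n is the weak order. *)
HB.instance Definition _ n := Order.Le_isPOrder.Build weak_display (asm n)
  (@asm_weak_le_refl n) (@asm_weak_le_anti n) (@asm_weak_le_trans n).
HB.instance Definition _ n := Order.Le_isPOrder.Build weak_display (mt n)
  (@mt_weak_le_refl n) (@mt_weak_le_anti n) (@mt_weak_le_trans n).

Section MonotoneTriangleOfASM.
Variable n : nat.
Implicit Types A : asm n.

Definition asm_tilde A : 'M[int]_n :=
  \matrix_(i, j) \sum_(a < n | (a <= i)%N) A a j.

(* enum 'I_n is increasing, hence so is row_ones A i. *)
Definition row_ones A (i : 'I_n) : seq 'I_n :=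
  [seq j <- enum 'I_n | asm_tilde A i j == 1].

(* row_ones A i has size i.+1 (size_row_ones), so that the default value of nth
   is never used. *)
Definition asm_mt_fun A : {ffun tri n -> 'I_n} :=
  [ffun p => nth (tag p) (row_ones A (tag p)) (tcol p)].

Lemma count_row_ones A i (P : pred 'I_n) :
  (count P (row_ones A i))%:Z = \sum_(j | P j) asm_tilde A i j.
Proof.
rewrite /row_ones count_filter -sum1_count big_enum_cond /= big_mkcond /=.
rewrite [RHS]big_mkcond /= (big_morph Posz PoszD (erefl _)); apply: eq_bigr => j _.
have /and4P[_ _ /forallP /(_ j) /forallP /(_ i) + _] := asm_mxP A.
case: (P j) => //=; rewrite mxE !inE.
by case/orP=> /eqP ->.
Qed.

Lemma asm_row_sum A (i : 'I_n) : \sum_j A i j = 1.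
Proof.
have /and4P[_ /forallP rowA _ /eqP totA] := asm_mxP A.
case: n A i rowA totA => [|k] A i rowA totA; first by case: i.
have le1 a : 0 <= 1 - \sum_j A a j.
  have := forallP (rowA a) ord_max; rewrite (eq_bigl xpredT); last first.
    by move=> j; rewrite -ltnS ltn_ord.
  by rewrite !inE => /orP[] /eqP ->.
have sum0 : \sum_a (1 - \sum_j A a j) = 0.
  by rewrite sumrB totA sumr_const card_ord natz subrr.
have := psumr_eq0P (fun a _ => le1 a) sum0.
by move=> /(_ i isT) /subr0_eq ->.
Qed.

Lemma size_row_ones A (i : 'I_n) : size (row_ones A i) = i.+1.
Proof.
rewrite -count_predT; apply/eqP; rewrite -eqz_nat count_row_ones.
under eq_bigr do rewrite mxE.
rewrite exchange_big /=; under eq_bigr do rewrite asm_row_sum.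
rewrite sumr_const natz eqz_nat; apply/eqP.
rewrite -sum1_card -[RHS]card_ord -sum1_card.
by rewrite (big_ord_widen n (fun=> 1%N) (ltn_ord i)); apply: eq_bigl => a.
Qed.

Lemma count_row_onesS A (i i' c : 'I_n) : i' = i.+1 :> nat ->
  let cnt k := count (fun j : 'I_n => (j <= c)%N) (row_ones A k) in
  (cnt i <= cnt i' <= (cnt i).+1)%N.
Proof.
move=> i'E /=; set P := fun j : 'I_n => _.
have : (count P (row_ones A i'))%:Z
    = \sum_(j < n | (j <= c)%N) A i' j + (count P (row_ones A i))%:Z.
  rewrite !count_row_ones -big_split; apply: eq_bigr => j _ /=; rewrite !mxE.
  rewrite (bigD1 i') //=; congr (_ + _); apply: eq_bigl => a.
  by rewrite -val_eqE /= i'E; lia.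
have /and4P[_ /forallP /(_ i') /forallP /(_ c) + _ _] := asm_mxP A.
by rewrite !inE => /orP[] /eqP ->; lia.
Qed.

Lemma sorted_row_ones A i : sorted ltn (map val (row_ones A i)).
Proof.
rewrite sorted_map; apply: sorted_filter; first by move=> a b c; apply: ltn_trans.
by rewrite -sorted_map val_enum_ord iota_ltn_sorted.
Qed.

Lemma nth_sorted_leq (s : seq nat) (x0 k c : nat) : sorted ltn s ->
  (k < size s)%N -> (nth x0 s k <= c)%N = (k < count (fun x => (x <= c)%N) s)%N.
Proof.
elim: s k => //= x s IHs k pxs.
have lt_xs : all (ltn x) s by apply: order_path_min pxs => a b d; apply: ltn_trans.
have [le_xc|lt_cx] := leqP x c.
  by case: k => [|k]; rewrite ?le_xc //= ltnS => /(IHs _ (path_sorted pxs)).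
rewrite (_ : count _ s = 0%N); last first.
  apply/eqP; rewrite -leqn0 leqNgt -has_count; apply/hasPn => y /(allP lt_xs) /=.
  by lia.
case: k => [_|k] /=; first by rewrite leqNgt lt_cx.
rewrite ltnS => ltk; have /= := allP lt_xs _ (mem_nth x0 ltk); lia.
Qed.

Lemma asm_mt_fun_leq A (p : tri n) (c : 'I_n) :
  (asm_mt_fun A p <= c)%N =
  (tcol p < count (fun j : 'I_n => (j <= c)%N) (row_ones A (tag p)))%N.
Proof.
have ltp : (tcol p < size (row_ones A (tag p)))%N.
  by rewrite size_row_ones; apply: (ltn_ord (tagged p)).
rewrite ffunE -(nth_map (tag p) (val (tag p)) val ltp) nth_sorted_leq.
- by rewrite count_map.
- exact: sorted_row_ones.
- by rewrite size_map.
Qed.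

Lemma asm_mt_subproof A : is_mt (asm_mt_fun A).
Proof.
apply/forallP=> p; apply/forallP=> q; apply/and3P; split; apply/implyP.
- case/andP=> /eqP rowE /eqP colE.
  have tagE : tag q = tag p by apply: val_inj.
  have ltq : (tcol q < size (row_ones A (tag p)))%N.
    by rewrite -tagE size_row_ones; apply: (ltn_ord (tagged q)).
  have ltp : (tcol p < size (row_ones A (tag p)))%N by rewrite -ltnS -colE ltnW.
  rewrite !ffunE tagE -!(nth_map (tag p) (val (tag p)) val) //.
  apply: (sorted_ltn_nth ltn_trans); rewrite ?inE ?size_map ?colE //.
    exact: sorted_row_ones.
  by rewrite -colE.
- case/andP=> /eqP rowE /eqP colE; rewrite asm_mt_fun_leq.
  have := leqnn (asm_mt_fun A q); rewrite asm_mt_fun_leq colE => lt_c.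
  by have /andP[le_c _] := count_row_onesS A (asm_mt_fun A q) rowE; apply: leq_trans le_c.
- case/andP=> /eqP rowE /eqP colE; rewrite asm_mt_fun_leq.
  have := leqnn (asm_mt_fun A q); rewrite asm_mt_fun_leq colE => lt_c.
  have /andP[_ le_c] := count_row_onesS A (asm_mt_fun A q) rowE.
  by rewrite -ltnS; apply: leq_trans le_c.
Qed.

Definition asm_mt A : mt n := Mt (asm_mt_subproof A).

End MonotoneTriangleOfASM.

(* Main.v *)
Require Import Defs.
From mathcomp Require Import all_boot all_order all_algebra.
From mathcomp Require Import zify.

(** The row sums of the partial column sums of an alternating sign matrix A
    are its corner sums, so rk_A(i, j) is the number of entries of row i of the
    monotone triangle m_A that are at most j.  An increasing list is determined
    by these counts, and it decreases entrywise exactly when the counts grow.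
    Hence A |-> m_A turns the comparison of corner sums in row i into the
    entrywise comparison of row i of the triangles ([asm_mt_row_le]); in
    particular it is injective, and A and B have the same corner sums outside
    row i iff m_A and m_B agree outside row i ([asm_mt_agree_off]).

    It is surjective because a monotone triangle m gives back a matrix, namely
    the difference of the indicators of consecutive rows of m.  The column
    partial sums of this matrix telescope to indicators, and its row partial
    sums are differences of counts in consecutive rows, which the interlacing
    of m forces to be 0 or 1 ([mt_below_interlace]).

    Therefore pi_i(A) and pi_i(m_A) are minima of corresponding sets for
    corresponding orders, and they correspond ([mt_pi_asm_mt]).  The bijection
    thus carries the generating steps of one weak order to those of the other,
    hence also their reflexive transitive closures. *)

Set Implicit Arguments.
Unset Strict Implicit.
Unset Printing Implicit Defensive.

Import Order.TTheory GRing.Theory Num.Theory.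
Local Open Scope ring_scope.

Lemma connect_homo (T T' : finType) (e : rel T) (e' : rel T') (f : T -> T') :
  {homo f : x y / e x y >-> e' x y} ->
  {homo f : x y / connect e x y >-> connect e' x y}.
Proof.
move=> fe x _ /connectP[p + ->]; elim: p x => //= y p IHp x /andP[exy /IHp].
exact/connect_trans/connect1/fe.
Qed.

(** * Corner sums and rows of monotone triangles *)

Section CornerSums.
Variable n : nat.
Implicit Types A B C : asm n.

Definition tri_pos (i : 'I_n) (k : 'I_i.+1) : tri n :=
  Tagged (fun i : 'I_n => 'I_i.+1) k.

Lemma rk_count_row_ones A (i c : 'I_n) :
  rk A i c = (count (fun j : 'I_n => (j <= c)%N) (row_ones A i))%:Z.
Proof.
rewrite count_row_ones /rk exchange_big /=.
by apply: eq_bigr => j _; rewrite mxE.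
Qed.

(** Rows of m_A are increasing, so entry k is at most c iff more than k entries
    of the row are. *)
Lemma asm_mt_leq_rk A (p : tri n) (c : 'I_n) :
  (asm_mt A p <= c)%N = ((tcol p)%:Z < rk A (tag p) c).
Proof. by rewrite rk_count_row_ones asm_mt_fun_leq ltz_nat. Qed.

Lemma asm_mt_row_le A B (i : 'I_n) :
  mt_row_le i (asm_mt A) (asm_mt B) = [forall j, rk B i j <= rk A i j].
Proof.
apply/forallP/forallP => [le_m c | le_rk p].
  rewrite !rk_count_row_ones lez_nat.
  (* If count B = k + 1 then the k-th entry of B, hence that of A, is <= c. *)
  case cntB: (count _ (row_ones B i)) => [//|k].
  have ltki : (k < i.+1)%N by rewrite -cntB -(size_row_ones B i) count_size.
  have /implyP/(_ (eqxx _)) le_AB := le_m (tri_pos (Ordinal ltki)).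
  have le_Bc : (asm_mt B (tri_pos (Ordinal ltki)) <= c)%N.
    by rewrite asm_mt_fun_leq cntB.
  by have := leq_trans le_AB le_Bc; rewrite asm_mt_fun_leq.
apply/implyP => /eqP /val_inj rowp; rewrite asm_mt_leq_rk.
have := leqnn (asm_mt B p); rewrite asm_mt_leq_rk => ltB.
by apply: lt_le_trans ltB _; rewrite rowp.
Qed.

Lemma asm_mt_inj : injective (@asm_mt n).
Proof.
have le_eq A B : asm_mt A = asm_mt B -> asm_strong_le A B.
  move=> eqm; apply/forallP => i; rewrite -asm_mt_row_le eqm.
  by apply/forallP => p; apply/implyP.
by move=> A B eqm; apply: asm_strong_le_anti; rewrite !le_eq.
Qed.

Lemma asm_mt_agree_off (i : nat) A B :
  mt_agree_off i (asm_mt A) (asm_mt B) = asm_agree_off i A B.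
Proof.
apply/forallP/forallP => [eq_m a | eq_rk p].
  apply/forallP => b; apply/implyP => nai.
  have le_m p : trow p = a -> asm_mt B p = asm_mt A p.
    by move=> rowp; apply/eqP/(implyP (eq_m p)); rewrite rowp.
  rewrite eq_le; apply/andP; split; move: b; apply/forallP;
    rewrite -asm_mt_row_le; apply/forallP => p; apply/implyP => /eqP /le_m;
    by move=> ->.
apply/implyP => npi.
have rk_row b : rk B (tag p) b = rk A (tag p) b.
  exact/eqP/(implyP (forallP (eq_rk (tag p)) b)).
have le_row (C D : asm n) : (forall b, rk C (tag p) b = rk D (tag p) b) ->
    (asm_mt C p <= asm_mt D p)%N.
  move=> eqCD; have: mt_row_le (tag p) (asm_mt C) (asm_mt D).
    by rewrite asm_mt_row_le; apply/forallP => b; rewrite eqCD.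
  by move=> /forallP/(_ p); rewrite eqxx.
by apply/eqP/val_inj/anti_leq; rewrite !le_row.
Qed.

(** Strong order looks at every row, the minimality of pi_i on triangles at
    row i only; among matrices that agree with A outside row i the other rows
    only contribute equalities. *)
Lemma asm_strong_le_agree_off (i : 'I_n) A B C :
    asm_agree_off i A B -> asm_agree_off i A C ->
  asm_strong_le B C = mt_row_le i (asm_mt B) (asm_mt C).
Proof.
move=> AB AC; rewrite asm_mt_row_le; apply/forallP/idP => [/(_ i) //|le_i a].
have [-> //|nai] := eqVneq a i; apply/forallP => b.
have/implyP/(_ nai)/eqP-> := forallP (forallP AB a) b.
by have/implyP/(_ nai)/eqP-> := forallP (forallP AC a) b.
Qed.

End CornerSums.

(** * The alternating sign matrix of a monotone triangle *)

Section MatrixOfTriangle.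
Variable n : nat.
Implicit Types (m : mt n) (i c j : 'I_n) (k : nat).

(** Here rows are counted from 1, and row 0 is empty: it is the one subtracted
    from the first row. *)
Definition mt_ind m k j : bool :=
  [exists p : tri n, ((trow p).+1 == k) && (m p == j)].

Definition mt_below m k c : nat := (\sum_(j < n | (j <= c)%N) mt_ind m k j)%N.

Definition mt_row m i : seq 'I_n :=
  [seq m (tri_pos l) | l <- enum 'I_i.+1].

Lemma mt_ind0 m j : mt_ind m 0 j = false.
Proof. by apply/existsP => -[]. Qed.

Lemma mt_indS m i j : mt_ind m i.+1 j = (j \in mt_row m i).
Proof.
apply/existsP/mapP => [[[r k] /andP[rowp /eqP <-]] | [k _ ->]].
  move: rowp; rewrite eqSS => /eqP /val_inj /= ri; case: i / ri.
  by exists k; rewrite ?mem_enum.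
by exists (tri_pos k); rewrite !eqxx.
Qed.

Lemma size_mt_row m i : size (mt_row m i) = i.+1.
Proof. by rewrite size_map size_enum_ord. Qed.

Lemma sorted_mt_row m i : sorted ltn (map val (mt_row m i)).
Proof.
apply/(sortedP 0%N) => k; rewrite size_map size_mt_row => ltk.
have ltk' : (k < i.+1)%N by apply: ltnW.
have entry l (ltl : (l < i.+1)%N) :
    nth 0%N (map val (mt_row m i)) l = m (tri_pos (Ordinal ltl)).
  rewrite -map_comp (nth_map (Ordinal ltl)) ?size_enum_ord //=.
  by rewrite (nth_ord_enum (Ordinal ltl) (Ordinal ltl)).
rewrite !entry; have /forallP/(_ (tri_pos (Ordinal ltk'))) := mt_funP m.
move=> /forallP/(_ (tri_pos (Ordinal ltk))) /and3P[/implyP + _ _]; apply.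
by rewrite !eqxx.
Qed.

Lemma sum_mt_indS m i (P : pred 'I_n) :
  (\sum_(j | P j) mt_ind m i.+1 j)%N = count P (mt_row m i).
Proof.
have uniq_row : uniq (mt_row m i).
  rewrite -(map_inj_uniq val_inj).
  by apply: (sorted_uniq ltn_trans ltnn); apply: sorted_mt_row.
rewrite -sum1_count [RHS]big_mkcond big_uniq //= [RHS]big_mkcond [LHS]big_mkcond /=.
by apply: eq_bigr => j _; rewrite mt_indS; case: (j \in _); case: (P j).
Qed.

Lemma mt_below0 m c : mt_below m 0 c = 0%N.
Proof. by rewrite /mt_below big1 // => j _; rewrite mt_ind0. Qed.

Lemma mt_belowS_size m i c : (mt_below m i.+1 c <= i.+1)%N.
Proof. by rewrite /mt_below sum_mt_indS -(size_mt_row m i) count_size. Qed.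

Lemma mt_leq_below m (p : tri n) c :
  (m p <= c)%N = (tcol p < mt_below m (trow p).+1 c)%N.
Proof.
case: p => i l; rewrite /mt_below /trow /tcol /= sum_mt_indS.
have -> : m (Tagged (fun i : 'I_n => 'I_i.+1) l)
    = nth 0%N (map val (mt_row m i)) l :> nat.
  by rewrite -map_comp (nth_map l) ?size_enum_ord //= nth_ord_enum.
rewrite nth_sorted_leq ?count_map ?size_map -?enumT ?size_enum_ord //.
exact: sorted_mt_row.
Qed.

(** If a row has t + 1 entries that are at most c, then its t-th entry (from 0)
    is one of them, and it bounds the t-th entry of the next row; so no entry
    below c is lost.  If the next row has t + 2 of them, its entry t + 1 bounds
    the t-th entry of the row above, so at most one is gained. *)
Lemma mt_below_interlace m i c :
  (mt_below m i c <= mt_below m i.+1 c <= (mt_below m i c).+1)%N.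
Proof.
have [i0|i_gt0] := posnP (i : nat).
  by have := mt_belowS_size m i c; rewrite i0 mt_below0; lia.
have lti' : (i.-1 < n)%N by have := ltn_ord i; lia.
pose i' := Ordinal lti'; have i'E : i'.+1 = i by rewrite /= prednK.
have mtP p q := and3P (forallP (forallP (mt_funP m) p) q).
apply/andP; split.
  case E: (mt_below m i c) => [//|t].
  have ltt' : (t < i'.+1)%N.
    by rewrite -E -{1}i'E mt_belowS_size.
  have ltt : (t < i.+1)%N by apply: ltnW; rewrite ltnS -i'E.
  pose p := tri_pos (Ordinal ltt'); pose q := tri_pos (Ordinal ltt).
  have le_qp : (m q <= m p)%N.
    by have [_ /implyP + _] := mtP q p; apply; rewrite /trow /tcol /= prednK ?eqxx.
  have le_pc : (m p <= c)%N by rewrite mt_leq_below (_ : (trow p).+1 = i) ?E.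
  by have := leq_trans le_qp le_pc; rewrite mt_leq_below.
case E: (mt_below m i.+1 c) => [//|[//|t]]; rewrite ltnS.
have ltt : (t.+1 < i.+1)%N by rewrite -E mt_belowS_size.
have ltt' : (t < i'.+1)%N by rewrite i'E.
pose p := tri_pos (Ordinal ltt'); pose q := tri_pos (Ordinal ltt).
have le_pq : (m p <= m q)%N.
  by have [_ _ /implyP +] := mtP p q; apply; rewrite /trow /tcol /= prednK ?eqxx.
have le_qc : (m q <= c)%N by rewrite mt_leq_below (_ : (trow q).+1 = i.+1) ?E.
by have := leq_trans le_pq le_qc; rewrite mt_leq_below (_ : (trow p).+1 = i).
Qed.

Definition asm_of_mt_mx m : 'M[int]_n :=
  \matrix_(i, j) ((mt_ind m i.+1 j)%:Z - (mt_ind m i j)%:Z).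

Lemma col_sum_asm_of_mt m i j :
  \sum_(a < n | (a <= i)%N) asm_of_mt_mx m a j = (mt_ind m i.+1 j)%:Z.
Proof.
under eq_bigr do rewrite mxE.
have /= <- := big_ord_widen _
  (fun a : nat => (mt_ind m a.+1 j)%:Z - (mt_ind m a j)%:Z) (ltn_ord i).
rewrite -(big_mkord xpredT
  (fun a : nat => (mt_ind m a.+1 j)%:Z - (mt_ind m a j)%:Z)).
by rewrite telescope_sumr // mt_ind0 subr0.
Qed.

Lemma row_sum_asm_of_mt m i c :
  \sum_(j < n | (j <= c)%N) asm_of_mt_mx m i j
  = (mt_below m i.+1 c)%:Z - (mt_below m i c)%:Z.
Proof.
rewrite /mt_below !(big_morph Posz PoszD (erefl _)) -sumrB.
by apply: eq_bigr => j _; rewrite mxE.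
Qed.

Lemma sum_mt_ind m k : (k <= n)%N -> (\sum_j mt_ind m k j)%N = k.
Proof.
case: k => [_|k ltkn]; first by rewrite big1 // => j _; rewrite mt_ind0.
by rewrite (sum_mt_indS m (Ordinal ltkn)) count_predT size_mt_row.
Qed.

Lemma asm_of_mt_subproof m : is_asm (asm_of_mt_mx m).
Proof.
apply/and4P; split.
- apply/forallP => i; apply/forallP => j; rewrite mxE.
  by case: (mt_ind m i.+1 j); case: (mt_ind m i j).
- apply/forallP => i; apply/forallP => c; rewrite row_sum_asm_of_mt !inE.
  by have := mt_below_interlace m i c; lia.
- apply/forallP => j; apply/forallP => i; rewrite col_sum_asm_of_mt.
  by case: (mt_ind m i.+1 j).
apply/eqP; rewrite (eq_bigr (fun=> 1)); first by rewrite sumr_const card_ord natz.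
move=> i _; under eq_bigr do rewrite mxE.
rewrite sumrB -!(big_morph Posz PoszD (erefl _)) !sum_mt_ind ?ltn_ord 1?ltnW //.
by lia.
Qed.

Definition asm_of_mt m : asm n := Asm (asm_of_mt_subproof m).

(** The same counts of entries below each threshold, hence the same entries:
    the partial column sums of the matrix are the row indicators of m. *)
Lemma asm_of_mtK : cancel asm_of_mt (@asm_mt n).
Proof.
move=> m; apply/val_inj/ffunP => p.
have same_leq (c : 'I_n) : (asm_mt (asm_of_mt m) p <= c)%N = (m p <= c)%N.
  rewrite asm_mt_fun_leq mt_leq_below -!ltz_nat count_row_ones.
  rewrite /mt_below (big_morph Posz PoszD (erefl _)); congr (_ < _).
  by apply: eq_bigr => j _; rewrite mxE; apply: col_sum_asm_of_mt.
by apply/val_inj/anti_leq; rewrite same_leq leqnn -same_leq leqnn.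
Qed.

End MatrixOfTriangle.

(** * Minima in row i and weak order *)

Section WeakOrder.
Variable n : nat.
Implicit Types (A B : asm n) (m : mt n).

Lemma asm_mtK : cancel (@asm_mt n) (@asm_of_mt n).
Proof. exact: inj_can_sym (@asm_of_mtK n) (@asm_mt_inj n). Qed.

(** A minimal row is unique because the entrywise comparison of row i is
    antisymmetric on triangles that agree outside row i. *)
Lemma mt_pi_unique (i : 'I_n.-1) m m' :
    mt_agree_off i m m' ->
    (forall m'', mt_agree_off i m m'' -> mt_row_le i m' m'') ->
  mt_pi i m = m'.
Proof.
move=> agr' min'; rewrite /mt_pi; case: pickP => [m1 | /(_ m')] /=; last first.
  by rewrite agr' => /forallP[]; move=> m''; apply/implyP/min'.
case/andP => agr1 /forallP min1; apply/val_inj/ffunP => p.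
have [rowp | nrowp] := eqVneq (trow p) i.
  have /forallP/(_ p) := implyP (min1 m') agr'.
  have /forallP/(_ p) := min' _ agr1.
  by rewrite rowp eqxx /= => le1 le2; apply/val_inj/anti_leq; rewrite le1 le2.
have /implyP/(_ nrowp)/eqP-> := forallP agr1 p.
by have /implyP/(_ nrowp)/eqP-> := forallP agr' p.
Qed.

(** Being the minimum defining pi_i(A) and the one defining pi_i(m_A) are the
    same condition on corresponding objects, so that one is attained iff the
    other is. *)
Lemma mt_pi_asm_mt (i : 'I_n.-1) A : mt_pi i (asm_mt A) = asm_mt (asm_pi i A).
Proof.
pose i' : 'I_n := widen_ord (leq_pred n) i.
have minE B : asm_agree_off i A B ->
    [forall C, asm_agree_off i A C ==> asm_strong_le B C]
    = [forall m, mt_agree_off i (asm_mt A) m ==> mt_row_le i (asm_mt B) m].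
  move=> AB; apply/forallP/forallP => [minB m | minB C]; apply/implyP.
    rewrite -(asm_of_mtK m) asm_mt_agree_off => Am.
    by rewrite -(@asm_strong_le_agree_off _ i' A) // (implyP (minB _)).
  move=> AC; rewrite (@asm_strong_le_agree_off _ i' A) //.
  by apply: (implyP (minB _)); rewrite asm_mt_agree_off.
rewrite /asm_pi; case: pickP => [B /andP[AB] | noB] /=.
  rewrite minE // => /forallP minB; apply: mt_pi_unique => [|m Am].
    by rewrite asm_mt_agree_off.
  exact: (implyP (minB m)).
rewrite /mt_pi; case: pickP => // m; rewrite -(asm_of_mtK m).
by case/andP; rewrite asm_mt_agree_off => Am; rewrite -minE // => minm;
  have := noB (asm_of_mt m); rewrite Am minm.
Qed.

Lemma asm_mt_weak_step A B :
  mt_weak_step (asm_mt A) (asm_mt B) = asm_weak_step A B.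
Proof.
rewrite /mt_weak_step /asm_weak_step (inj_eq (@asm_mt_inj n)); congr (_ && _).
by apply: eq_existsb => i; rewrite mt_pi_asm_mt (inj_eq (@asm_mt_inj n)).
Qed.

Lemma asm_mt_weak_le A B : mt_weak_le (asm_mt A) (asm_mt B) = asm_weak_le A B.
Proof.
apply/idP/idP; last by apply: connect_homo => {}A {}B; rewrite asm_mt_weak_step.
rewrite -{2}(asm_mtK A) -{2}(asm_mtK B); apply: connect_homo => m m'.
by rewrite -asm_mt_weak_step !asm_of_mtK.
Qed.

End WeakOrder.

Theorem proposition3p10 (n : nat) (hn : (0 < n)%N) :
  (forall (A : asm n) (i : 'I_n.-1),
     mt_pi i (asm_mt A) = asm_mt (asm_pi i A)) /\
  (bijective (@asm_mt n) /\
   forall A B : asm n, (asm_mt A <= asm_mt B)%O = (A <= B)%O).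
Proof.
split; first by move=> A i; apply: mt_pi_asm_mt.
split; last exact: asm_mt_weak_le.
by exists (@asm_of_mt n); [apply: asm_mtK | apply: asm_of_mtK].
Qed.
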